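(* For each odd integer $N\geq 3$ there is at least one integer triple $(a,b,c)$ with $0<a+1<b<c$, $c-a=N$, and $$(a+1)^2+\cdots+b^2=(b+1)^2+\cdots+c^2 .$$ Furthermore, for each odd $N\ge 3$ there is a plane $\Pi_N\subset\mathbb{R}^3$ and an infinite family of distinct integer triples $(a_n,b_n,c_n)$, each satisfying $0<a_n+1<b_n<c_n$ and $(a_n+1)^2+\cdots+b_n^2=(b_n+1)^2+\cdots+c_n^2$, all lying in $\Pi_N$ and all having $c_n-a_n$ odd; moreover the planes $\Pi_N$ are different for different $N$. *)

(* Defs.v *)
From HB Require Import structures.
From mathcomp Require Import all_boot all_order all_algebra.
From mathcomp Require Import classical_sets reals.

Set Implicit Arguments.
Unset Strict Implicit.
Unset Printing Implicit Defensive.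

Import Order.TTheory GRing.Theory Num.Theory.
Local Open Scope ring_scope.
Local Open Scope classical_set_scope.

Definition oddz (m : int) : bool := ~~ (2 %| m)%Z.

(* (a + 1)^2 + ... + b^2; meaningful only for a <= b, the number of terms
   being the absolute value of b - a. *)
Definition sum_squares (a b : int) : int :=
  \sum_(0 <= i < `|b - a|%N) (a + 1 + i%:Z) ^+ 2.

Definition consecutive_squares (a b c : int) : Prop :=
  0 < a + 1 /\ a + 1 < b /\ b < c /\ sum_squares a b = sum_squares b c.

(* Affine planes of R^3, not necessarily through the origin. *)
Definition is_plane (R : realType) (P : set 'rV[R]_3) : Prop :=
  exists (u : 'rV[R]_3) (d : R),
    u != 0 /\ P = [set x | \sum_(i < 3) u 0 i * x 0 i = d].

Definition int_point (R : realType) (a b c : int) : 'rV[R]_3 :=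
  \row_(i < 3) [:: a%:~R; b%:~R; c%:~R]`_i.

(* Main.v *)
(** Put [N = c - a], [S = a + c + 1] and [D = 2 b - a - c]. The equation
    between the two sums of squares becomes
      [D^3 - D = 3 S (N^2 - S D - D^2)],
    of which [D = 1], [S = N^2 - 1] is a solution for every odd [N].
    The surface contains the line [S = D = 0], so its section by the plane
    [S = u D], where [u = N^2 - 1], is that line together with the conic
      [(3 u^2 + 3 u + 1) D^2 - 3 u M^2 = 1],    [M = c - a].
    This Pell-type conic passes through [(M, D) = (N, 1)], and multiplication
    by the square of the corresponding unit produces infinitely many points;
    in the coordinates [(a, b, c)] this multiplication preserves integrality. *)
Require Import Defs.
From HB Require Import structures.
From mathcomp Require Import all_boot all_order all_algebra.
From mathcomp Require Import classical_sets reals.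
From mathcomp Require Import zify ring.

Set Implicit Arguments.
Unset Strict Implicit.
Unset Printing Implicit Defensive.

Import Order.TTheory GRing.Theory Num.Theory.
Local Open Scope ring_scope.
Local Open Scope classical_set_scope.

Lemma oddzP (m : int) : oddz m -> exists k : int, m = 2 * k + 1.
Proof.
rewrite /oddz => m_odd; exists (m %/ 2)%Z; lia.
Qed.

Lemma oddz_double_add1 (k : int) : oddz (2 * k + 1).
Proof. by rewrite /oddz; lia. Qed.

Lemma sum_squares_closed (a b : int) : a <= b ->
  6 * sum_squares a b =
    b * (b + 1) * (2 * b + 1) - a * (a + 1) * (2 * a + 1).
Proof.
move=> le_ab; rewrite /sum_squares.
have [n ->] : exists n : nat, b = a + n%:Z by exists (absz (b - a)); lia.
rewrite (addrC a) addrK absz_nat addrC.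
elim: n => [|n IHn]; first by rewrite big_geq //; ring.
rewrite big_nat_recr //= mulrDr IHn intS; ring.
Qed.

Lemma consecutive_squares_cubic (a b c : int) :
  0 < a + 1 -> a + 1 < b -> b < c ->
  2 * (b * (b + 1) * (2 * b + 1)) =
    a * (a + 1) * (2 * a + 1) + c * (c + 1) * (2 * c + 1) ->
  consecutive_squares a b c.
Proof.
move=> a_ge0 lt_ab lt_bc eq_abc; do 3!split=> //.
have := @sum_squares_closed a b; have := @sum_squares_closed b c; lia.
Qed.

Definition gap (t : int * int * int) : int := t.2 - t.1.1.

Definition defect (t : int * int * int) : int := 2 * t.1.2 - t.1.1 - t.2.

(** The first two clauses are the plane and the conic. The last three are invariants of the Pell
    step: the signs yield the ordering of the triple, and the parity is carried along the orbit. *)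
Definition on_conic (N : int) (t : int * int * int) : Prop :=
  let u := N ^+ 2 - 1 in
  [/\ t.1.1 + t.2 + 1 = u * defect t,
      (3 * u ^+ 2 + 3 * u + 1) * defect t ^+ 2 = 3 * u * gap t ^+ 2 + 1,
      0 < gap t, 0 < defect t & oddz (gap t)].

(** The ordering comes from [D < M < u * D]: the left inequality gives [a + 1 < b < c], the right
    one [0 < a + 1]. Both are proved on squares, eliminating [M ^+ 2] by the conic equation. *)
Lemma on_conic_consecutive (N a b c : int) : 3 <= N ->
  on_conic N (a, b, c) -> consecutive_squares a b c.
Proof.
move=> N_ge3; rewrite /on_conic /gap /defect /=.
have : 8 <= N ^+ 2 - 1 by nia.
move: (N ^+ 2 - 1) => u u_ge8.
set M := c - a; set D := 2 * b - a - c => -[eqS eqQ M_gt0 D_gt0 M_odd].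
have u_gt0 : 0 < 3 * u by lia.
have D2_gt0 : 0 < D ^+ 2 by rewrite exprn_gt0.
have u2D2_gt0 : 0 < u ^+ 2 * D ^+ 2 by rewrite mulr_gt0 ?exprn_gt0 //; lia.
have lt_DM : D < M.
  rewrite -(@ltr_pXn2r _ 2) ?nnegrE ?ltW // -subr_gt0 -(pmulr_rgt0 _ u_gt0).
  have -> : 3 * u * (M ^+ 2 - D ^+ 2) = 3 * (u ^+ 2 * D ^+ 2) + (D ^+ 2 - 1).
    rewrite mulrBr -[3 * u * _](addrK 1) -eqQ; ring.
  lia.
have lt_MS : M < u * D.
  rewrite -(@ltr_pXn2r _ 2) ?nnegrE ?ltW ?mulr_gt0 //; last by lia.
  rewrite -subr_gt0 -(pmulr_rgt0 _ u_gt0).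
  have -> : 3 * u * ((u * D) ^+ 2 - M ^+ 2) =
      (3 * (u * u ^+ 2) - 3 * u ^+ 2 - 3 * u - 1) * D ^+ 2 + 1.
    rewrite mulrBr -[3 * u * M ^+ 2](addrK 1) -eqQ; ring.
  rewrite ltr_wpDl // mulr_ge0 ?ltW // subr_gt0.
  have : 8 * u <= u ^+ 2 by rewrite expr2 ler_wpM2r //; lia.
  have : 8 * u ^+ 2 <= u * u ^+ 2 by rewrite ler_wpM2r ?sqr_ge0.
  lia.
apply: consecutive_squares_cubic; try lia.
have eqA : 2 * a = u * D - M - 1 by lia.
have eqB : 2 * b = u * D + D - 1 by lia.
have eqC : 2 * c = u * D + M - 1 by lia.
(* Only the doubles of [a], [b], [c] are polynomials in [u], [D], [M]; the factor 4 lets the cubic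
   equation be written in them alone. *)
apply: (@mulfI _ 4) => //.
transitivity ((2 * b) * (2 * b + 2) * (2 * b + 1) * 2); first by ring.
transitivity ((2 * a) * (2 * a + 2) * (2 * a + 1) +
              (2 * c) * (2 * c + 2) * (2 * c + 1)); last by ring.
rewrite eqA eqB eqC; apply/eqP; rewrite -subr_eq0; apply/eqP.
(* On the plane the cubic splits: [D] is the factor of the line S = D = 0, the other factor that of
   the conic. *)
transitivity (2 * D * ((3 * u ^+ 2 + 3 * u + 1) * D ^+ 2
                       - (3 * u * M ^+ 2 + 1))); first by ring.
by rewrite eqQ subrr mulr0.
Qed.

(* With [p = 3 u] and [q = p N^2 + 1], this adds [2 X] to the gap and [2 Y] to
   the defect, i.e. multiplies [D sqrt q + M sqrt p] by
   [(sqrt q + N sqrt p)^2 = 2 q - 1 + 2 N sqrt (p q)]. *)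
Definition conic_step (N : int) (t : int * int * int) : int * int * int :=
  let u := N ^+ 2 - 1 in
  let q := 3 * u ^+ 2 + 3 * u + 1 in
  let X := (q - 1) * gap t + N * q * defect t in
  let Y := (q - 1) * defect t + 3 * N * u * gap t in
  (t.1.1 + u * Y - X, t.1.2 + (u + 1) * Y, t.2 + u * Y + X).

Lemma gap_conic_step (N : int) t (u := N ^+ 2 - 1)
    (q := 3 * u ^+ 2 + 3 * u + 1) :
  gap (conic_step N t) =
    gap t + 2 * ((q - 1) * gap t + N * q * defect t).
Proof. rewrite /q /u {1 2}/gap /conic_step /=; ring. Qed.

Lemma defect_conic_step (N : int) t (u := N ^+ 2 - 1)
    (q := 3 * u ^+ 2 + 3 * u + 1) :
  defect (conic_step N t) =
    defect t + 2 * ((q - 1) * defect t + 3 * N * u * gap t).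
Proof. rewrite /q /u {1 2}/defect /conic_step /=; ring. Qed.

Lemma defect_conic_step_gt (N : int) t : 3 <= N ->
  on_conic N t -> defect t < defect (conic_step N t).
Proof.
move=> N_ge3 [_ _ M_gt0 D_gt0 _].
have u_gt0 : 0 < N ^+ 2 - 1 by nia.
have N_gt0 : 0 < N by lia.
rewrite defect_conic_step.
move: (gap t) (defect t) (N ^+ 2 - 1) M_gt0 D_gt0 u_gt0.
move=> M D u M_gt0 D_gt0 u_gt0.
by rewrite addrK ltrDl !(mulr_gt0, addr_gt0, exprn_gt0).
Qed.

Lemma on_conic_step (N : int) t : 3 <= N ->
  on_conic N t -> on_conic N (conic_step N t).
Proof.
move=> N_ge3 t_conic; have [eqS eqQ M_gt0 D_gt0 /oddzP[k eqM]] := t_conic.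
have u_gt0 : 0 < N ^+ 2 - 1 by nia.
have N_gt0 : 0 < N by lia.
split.
- rewrite defect_conic_step mulrDr -eqS /conic_step /=; ring.
- rewrite gap_conic_step defect_conic_step.
  move: eqQ; move: (gap t) (defect t) => M D eqQ.
  apply/eqP; rewrite -subr_eq0; apply/eqP.
  (* As q = p N^2 + 1, the multiplier has norm (2 q - 1)^2 - 4 p q N^2 = 1, so the difference of the
     two sides is invariant. *)
  transitivity ((3 * (N ^+ 2 - 1) ^+ 2 + 3 * (N ^+ 2 - 1) + 1) * D ^+ 2
                - (3 * (N ^+ 2 - 1) * M ^+ 2 + 1)); first by ring.
  by rewrite eqQ subrr.
- rewrite gap_conic_step.
  move: (gap t) (defect t) (N ^+ 2 - 1) M_gt0 D_gt0 u_gt0.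
  move=> M D u M_gt0 D_gt0 u_gt0.
  by rewrite addrK addr_gt0 // !(mulr_gt0, addr_gt0, exprn_gt0).
- exact: lt_trans D_gt0 (defect_conic_step_gt N_ge3 t_conic).
- rewrite gap_conic_step; set X := (X in 2 * X).
  have -> : gap t + 2 * X = 2 * (k + X) + 1 by rewrite eqM; ring.
  exact: oddz_double_add1.
Qed.

Lemma on_conic_start (N : int) : oddz N -> 3 <= N ->
  exists2 t, on_conic N t & gap t = N.
Proof.
move=> N_odd N_ge3; have [k eqN] := oddzP N_odd.
(* The solution of D = 1, M = N, S = N^2 - 1 for N = 2 k + 1. It gives the classical identities 3^2
   + 4^2 = 5^2, 10^2 + 11^2 + 12^2 = 13^2 + 14^2, and so on. *)
pose t : int * int * int :=
  (2 * k ^+ 2 + k - 1, 2 * k ^+ 2 + 2 * k, 2 * k ^+ 2 + 3 * k).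
have gapt : gap t = N by rewrite eqN /gap /=; ring.
have deft : defect t = 1 by rewrite /defect /=; ring.
exists t => //; split; rewrite ?gapt ?deft //; last by lia.
- rewrite eqN /=; ring.
- ring.
Qed.

Lemma on_conic_sequence (N : int) : oddz N -> 3 <= N ->
  exists2 t : nat -> int * int * int,
    injective t & forall n, on_conic N (t n).
Proof.
move=> N_odd N_ge3; have [t0 t0_conic _] := on_conic_start N_odd N_ge3.
pose t n := iter n (conic_step N) t0.
have t_conic n : on_conic N (t n).
  by elim: n => //= n; apply: on_conic_step.
exists t => //.
(* Distinctness of the triples follows from strict growth of the defect along the orbit. *)
have incr : {homo defect \o t : m n / (m < n)%N >-> m < n}.
  apply: homo_ltn; first exact: lt_trans.
  by move=> n; apply: defect_conic_step_gt.
move=> m n eq_t; have [/incr|/incr|//] := ltngtP m n;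
  by rewrite /= eq_t ltxx.
Qed.

Section Planes.
Variable R : realType.

(** Expanding S = u D with u + 1 = N^2 gives N^2 (a + c) - 2 (N^2 - 1) b = -1. *)
Definition conic_plane_normal (N : int) : 'rV[R]_3 :=
  int_point R (N ^+ 2) (- (2 * (N ^+ 2 - 1))) (N ^+ 2).

Definition conic_plane (N : int) : set 'rV[R]_3 :=
  [set x | \sum_(i < 3) conic_plane_normal N 0 i * x 0 i = -1].

Lemma conic_planeP (N : int) (x : 'rV[R]_3) :
  conic_plane N x <->
  (N ^+ 2)%:~R * x 0 0 + (- (2 * (N ^+ 2 - 1)))%:~R * x 0 1
    + (N ^+ 2)%:~R * x 0 2 = -1.
Proof.
rewrite /conic_plane /= !big_ord_recl big_ord0 addr0 !mxE /= addrA.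
have -> : lift ord0 ord0 = 1 :> 'I_3 by apply: val_inj.
by have -> : lift ord0 (lift ord0 ord0) = 2 :> 'I_3 by apply: val_inj.
Qed.

Lemma conic_plane_is_plane (N : int) : N != 0 -> is_plane (conic_plane N).
Proof.
move=> N_neq0; exists (conic_plane_normal N), (-1); split=> //.
apply/eqP => /rowP /(_ 0); rewrite !mxE /= => /eqP.
by rewrite intr_eq0 expf_eq0 (negbTE N_neq0).
Qed.

Lemma on_conic_plane (N a b c : int) :
  on_conic N (a, b, c) -> conic_plane N (int_point R a b c).
Proof.
case; rewrite /defect /= => eqS _ _ _ _.
apply/conic_planeP; rewrite !mxE /= -!intrM -!intrD.
have -> : -1 = (-1)%:~R :> R by [].
by congr intmul; lia.
Qed.

Lemma conic_plane_inj (N M : int) : 0 < N -> 0 < M ->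
  conic_plane N = conic_plane M -> N = M.
Proof.
move=> N_gt0 M_gt0 eqNM.
have sqN_neq0 : (N ^+ 2)%:~R != 0 :> R by rewrite intr_eq0 expf_neq0 ?gt_eqF.
(* The plane meets the first coordinate axis at -1 / N^2, which determines N up to sign. *)
pose x : 'rV[R]_3 := \row_(i < 3) [:: - (N ^+ 2)%:~R^-1; 0; 0]`_i.
have : conic_plane N x.
  by apply/conic_planeP; rewrite !mxE /= !mulr0 !addr0 mulrN divff.
rewrite eqNM => /conic_planeP; rewrite !mxE /= !mulr0 !addr0 mulrN.
move=> /oppr_inj /(canRL (mulfVK sqN_neq0)); rewrite mul1r => /intr_inj /eqP.
by rewrite eqrXn2 ?ltW // => /eqP.
Qed.

End Planes.

Theorem theorem1p3 (R : realType) :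
  (forall N : int, oddz N -> 3 <= N ->
     exists a b c : int, c - a = N /\ consecutive_squares a b c) /\
  (exists Pi : int -> set 'rV[R]_3,
     (forall N : int, oddz N -> 3 <= N ->
        is_plane (Pi N) /\
        exists t : nat -> int * int * int,
          injective t /\
          forall (n : nat) (a b c : int), t n = (a, b, c) ->
            consecutive_squares a b c /\ Pi N (int_point R a b c) /\
            oddz (c - a)) /\
     (forall N M : int, oddz N -> 3 <= N -> oddz M -> 3 <= M ->
        N <> M -> Pi N <> Pi M)).
Proof.
split=> [N N_odd N_ge3|].
  have [[[a b] c] abc_conic gap_abc] := on_conic_start N_odd N_ge3.
  by exists a, b, c; split=> //; apply: on_conic_consecutive abc_conic.
exists (@conic_plane R); split=> [N N_odd N_ge3|N M _ N_ge3 _ M_ge3 neqNM].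
  split; first by apply: conic_plane_is_plane; lia.
  have [t t_inj t_conic] := on_conic_sequence N_odd N_ge3.
  exists t; split=> // n a b c eq_t; have := t_conic n; rewrite eq_t.
  move=> abc_conic; split; first exact: on_conic_consecutive abc_conic.
  by split; [exact: on_conic_plane | case: abc_conic].
by move=> /conic_plane_inj eqNM; apply/neqNM/eqNM; lia.
Qed.
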